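(* There exist constants $c>0$ and $K_0>0$ and, for each integer $K>K_0$, a function $h:\mathbb{Z}_+^{K+1}\to\mathbb{Z}_+$ such that the following holds for every integer $K>K_0$. Let $a_1,\ldots,a_K$ be positive integers satisfying $$\frac{a_k}{a_1+\cdots+a_{k-1}}>4\log K\qquad\text{for all } k=2,\ldots,K,$$ and let $N>h(K,a_1,\ldots,a_K)$ be an integer such that the group $\mathbb{Z}_N$ is generated by the elements of $C=\{\pm a_1,\ldots,\pm a_K\}$. Let $X=X(\mathbb{Z}_N,C)$ be the circulant graph and let $\alpha$ be the maximum effective resistance between the two endpoints of an edge in $X$. Then no partition of $C$ into symmetric subsets $C_1\cup C_2$ satisfies $$\left(\frac12-c\sqrt{\alpha\log K}\right)L_X\preccurlyeq L_{X(\mathbb{Z}_N,C_i)}\preccurlyeq\left(\frac12+c\sqrt{\alpha\log K}\right)L_X\qquad\text{for all } i\in\{1,2\}.$$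
   Context: All logarithms are to base $6$. $\mathbb{Z}_N$ is the additive group of integers modulo $N$. A set $S\subseteq\mathbb{Z}_N$ is symmetric if $x\in S\iff -x\in S$. For a symmetric set $S\subseteq\mathbb{Z}_N\setminus\{0\}$, the circulant graph $X(\mathbb{Z}_N,S)$ is the undirected graph with vertex set $\mathbb{Z}_N$ in which $i,j$ are adjacent iff $i-j\in S$. The Laplacian of a graph $G=(V,E)$ is $L_G=\sum_{(u,v)\in E}(\chi_u-\chi_v)(\chi_u-\chi_v)^\top$, where $\chi_u\in\mathbb{R}^V$ is the indicator vector of $u$ and each undirected edge is counted once. The effective resistance between $u$ and $v$ in $G$ is $(\chi_u-\chi_v)^\top L_G^{\dagger}(\chi_u-\chi_v)$, where $L_G^\dagger$ is the pseudoinverse of $L_G$. For symmetric real matrices, $A\preccurlyeq B$ means that $B-A$ is positive semidefinite. *)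

(* Defs.v *)
From mathcomp Require Import all_boot all_order all_fingroup all_algebra.
From mathcomp Require Import boolp classical_sets reals exp.

Set Implicit Arguments.
Unset Strict Implicit.
Unset Printing Implicit Defensive.

Import Order.TTheory GRing.Theory Num.Theory.

Local Open Scope ring_scope.

Section Matrices.
Variable R : realType.

Definition psd n (M : 'M[R]_n) : Prop :=
  M^T = M /\ forall x : 'cV[R]_n, 0 <= (x^T *m M *m x) 0 0.

Definition loewner_le n (A B : 'M[R]_n) : Prop := psd (B - A).

Definition moore_penrose m n (A : 'M[R]_(m, n)) (P : 'M[R]_(n, m)) : Prop :=
  [/\ A *m P *m A = A, P *m A *m P = P,
      (A *m P)^T = A *m P & (P *m A)^T = P *m A].

(* The choice is vacuous: see [pseudoinverseP] and [moore_penrose_uniq].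
   This is not [pinvmx], which is only a partial inverse on the row space. *)
Definition pseudoinverse m n (A : 'M[R]_(m, n)) : 'M[R]_(n, m) :=
  xget 0 [set P | moore_penrose A P]%classic.

Lemma mulmx_tr_eq0 m n (A : 'M[R]_(m, n)) : A *m A^T = 0 -> A = 0.
Proof.
move=> A0; apply/matrixP => i j; rewrite mxE.
have /eqP := congr1 (fun M : 'M[R]_m => M i i) A0.
rewrite !mxE psumr_eq0; last by move=> k _; rewrite mxE -expr2 sqr_ge0.
by move=> /allP /(_ j (mem_index_enum _)); rewrite mxE -expr2 sqrf_eq0 => /eqP.
Qed.

Lemma gram_unit m n (A : 'M[R]_(m, n)) : row_free A -> A *m A^T \in unitmx.
Proof.
move=> Afree; rewrite -row_free_unit; apply/row_freeP.
suff /eqP : kermx (A *m A^T) = 0 by rewrite kermx_eq0 => /row_freeP.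
set N := kermx _.
have NA0 : N *m A = 0.
  by apply: mulmx_tr_eq0; rewrite trmx_mul mulmxA -(mulmxA N) mulmx_ker mul0mx.
by have [B AB] := row_freeP Afree; rewrite -[N]mulmx1 -AB mulmxA NA0 mul0mx.
Qed.

Lemma moore_penrose_exists m n (A : 'M[R]_(m, n)) : exists P, moore_penrose A P.
Proof.
have [r [C [D [<- uD uC]]]] : exists r (C : 'M_(m, r)) (D : 'M_(r, n)),
    [/\ C *m D = A, D *m D^T \in unitmx & C^T *m C \in unitmx].
  exists (\rank A), (col_base A), (row_base A); split.
  - exact: mulmx_base.
  - by apply/gram_unit/row_base_free.
  - rewrite -{2}[col_base A]trmxK; apply: gram_unit.
    by rewrite -row_leq_rank mxrank_tr col_leq_rank col_base_full.
have [D' DD' sD] : exists2 D', D *m D' = 1%:M & (D' *m D)^T = D' *m D.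
  exists (D^T *m invmx (D *m D^T)); first by rewrite mulmxA mulmxV.
  by rewrite !trmx_mul trmxK trmx_inv trmx_mul trmxK mulmxA.
have [C' C'C sC] : exists2 C', C' *m C = 1%:M & (C *m C')^T = C *m C'.
  exists (invmx (C^T *m C) *m C^T); first by rewrite -mulmxA mulVmx.
  by rewrite !trmx_mul trmxK trmx_inv trmx_mul trmxK mulmxA.
have AP : C *m D *m (D' *m C') = C *m C'.
  by rewrite -!mulmxA (mulmxA D) DD' mul1mx.
have PA : D' *m C' *m (C *m D) = D' *m D.
  by rewrite -!mulmxA (mulmxA C') C'C mul1mx.
exists (D' *m C'); split; rewrite ?AP ?PA //.
- by rewrite -!mulmxA (mulmxA C') C'C mul1mx.
- by rewrite -!mulmxA (mulmxA D) DD' mul1mx.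
Qed.

Lemma moore_penrose_uniq m n (A : 'M[R]_(m, n)) (P Q : 'M[R]_(n, m)) :
  moore_penrose A P -> moore_penrose A Q -> P = Q.
Proof.
move=> [aP pP sP tP] [aQ pQ sQ tQ].
have APQ : A *m P = A *m Q.
  by rewrite -sP -{1}aQ -mulmxA trmx_mul sQ sP mulmxA aP.
have PAQ : P *m A = Q *m A.
  by rewrite -tP -{1}aQ -mulmxA mulmxA trmx_mul tQ tP -mulmxA (mulmxA A) aP.
by rewrite -pP PAQ -mulmxA APQ mulmxA pQ.
Qed.

Lemma pseudoinverseP m n (A : 'M[R]_(m, n)) : moore_penrose A (pseudoinverse A).
Proof.
have [P AP] := moore_penrose_exists A.
exact: (@xgetPex _ 0 [set P | moore_penrose A P]%classic (ex_intro _ P AP)).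
Qed.

End Matrices.

(* A graph on ['I_n] is its adjacency relation [e], assumed symmetric;
   the condition [p.1 < p.2] counts each undirected edge once. *)
Section Graphs.
Variables (R : realType) (n : nat) (e : rel 'I_n).

Definition chi (u : 'I_n) : 'cV[R]_n := delta_mx u 0.

Definition laplacian : 'M[R]_n :=
  \sum_(p : 'I_n * 'I_n | (p.1 < p.2)%N && e p.1 p.2)
    (chi p.1 - chi p.2) *m (chi p.1 - chi p.2)^T.

Definition eff_res (u v : 'I_n) : R :=
  ((chi u - chi v)^T *m pseudoinverse laplacian *m (chi u - chi v)) 0 0.

(* Effective resistances are nonnegative, so the default value 0 matters only
   for an edgeless graph. *)
Definition max_edge_eff_res : R :=
  \big[Num.max/0]_(p : 'I_n * 'I_n | e p.1 p.2) eff_res p.1 p.2.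

End Graphs.

Definition symmetric_set N (S : {set 'Z_N}) : Prop :=
  forall x, (x \in S) = (- x \in S).

Definition circulant N (S : {set 'Z_N}) : rel 'Z_N :=
  fun i j => i - j \in S.

Definition pm_set N K (a : K.-tuple nat) : {set 'Z_N} :=
  [set (tnth a k)%:R | k : 'I_K] :|: [set - (tnth a k)%:R | k : 'I_K].

Definition log6 (R : realType) (x : R) : R := ln x / ln 6.

(* Main.v *)
Require Import Defs.
From mathcomp Require Import all_boot all_order all_fingroup all_algebra.
From mathcomp Require Import ring lra.
From mathcomp Require Import reals topology normedtype sequences exp trigo.

(** Two facts of opposite nature collide: edges of the circulant graph [X] have
    small effective resistance, so that [eps] is below an absolute constant, while
    every partition of the generators is unbalanced by a constant factor on a
    suitable character.

    Resistances are small because an edge [u v] has a detour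
    [u, u + s, v + s, v] of length three for each generator [s].  If [f] is the
    potential of a unit current from [u] to [v], its energy equals the drop
    [f u - f v], which is the resistance [r]; bounding the drop along each detour
    by Cauchy-Schwarz and summing over [s] gives [#|C| * r ^+ 2 <= 18 * r]
    ([circulant_eff_res_le]).  As [#|C| >= K], this yields [alpha <= 18 / K], and
    [log6 K <= K] then makes [alpha * log6 K] bounded and [eps <= 1 / 4].

    For the imbalance, name the parts so that [#|C2| <= #|C1|].  Consecutive [a_k]
    have ratio at least [4 * log6 K], which tends to infinity, so there is a
    frequency [t = j / N] for which [a_k * t] modulo 1 is close to 1/2 when [a_k]
    lies in [C1] and close to 0 otherwise ([lacunary_approx],
    [unbalanced_frequency]): the residues are prescribed one after the other, each
    adjustment being too small to disturb the earlier ones, and [N] itself serves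
    as the last and largest term of the sequence.  The character of frequency [j]
    has energy proportional to the sum of [1 - cos (2 * pi * s * t)] over the
    generators [s] ([character_energy]); these terms are close to 2 on [C1] and to
    0 on [C2].  At least 15/16 of the energy of [X] thus sits in [C1], against the upper
    bound [1 / 2 + eps <= 3 / 4] ([unbalanced_character]). *)

Set Implicit Arguments.
Unset Strict Implicit.
Unset Printing Implicit Defensive.

Import Order.TTheory GRing.Theory Num.Theory.
Import numFieldNormedType.Exports.

Local Open Scope ring_scope.

(** * Quadratic forms of Laplacians *)

Lemma chi_sub_mul (R : realType) n (u v : 'I_n) (x : 'cV[R]_n) :
  ((chi R u - chi R v)^T *m x) 0 0 = x u 0 - x v 0.
Proof.
by rewrite linearB /= /chi !trmx_delta mulmxBl -!rowE !mxE.
Qed.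

Lemma laplacian_form (R : realType) n (e : rel 'I_n) (x : 'cV[R]_n) :
  (x^T *m laplacian R e *m x) 0 0 =
  \sum_(p : 'I_n * 'I_n | (p.1 < p.2)%N && e p.1 p.2)
     (x p.1 0 - x p.2 0) ^+ 2.
Proof.
rewrite /laplacian mulmx_sumr mulmx_suml summxE; apply: eq_bigr => p _.
set b := chi R p.1 - chi R p.2.
have -> : x^T *m (b *m b^T) *m x = (b^T *m x)^T *m (b^T *m x).
  by rewrite trmx_mul trmxK !mulmxA.
by rewrite mxE big_ord1 mxE chi_sub_mul expr2.
Qed.

Lemma laplacian_sym (R : realType) n (e : rel 'I_n) :
  (laplacian R e)^T = laplacian R e.
Proof.
rewrite /laplacian raddf_sum /=; apply: eq_bigr => p _.
by rewrite trmx_mul trmxK.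
Qed.

(** Summing over ordered pairs makes the form of a circulant graph
    translation invariant, at the cost of counting each edge twice. *)
Lemma laplacian_form_ordered (R : realType) n (e : rel 'I_n) (x : 'cV[R]_n) :
  symmetric e ->
  (x^T *m laplacian R e *m x) 0 0 *+ 2 =
  \sum_i \sum_(j | e i j) (x i 0 - x j 0) ^+ 2.
Proof.
move=> esym; rewrite laplacian_form (pair_big_dep xpredT) /=.
set F := fun p : 'I_n * 'I_n => (x p.1 0 - x p.2 0) ^+ 2.
rewrite -/(\sum_(p | e p.1 p.2) F p).
rewrite [RHS](bigID (fun p : 'I_n * 'I_n => (p.1 < p.2)%N)) /=.
rewrite mulr2n; congr (_ + _); first by apply: eq_bigl => p; rewrite andbC.
rewrite [RHS](bigID (fun p : 'I_n * 'I_n => (p.2 < p.1)%N)) /=.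
rewrite [X in _ + X]big1 ?addr0; last first.
  move=> p /andP[/andP[_]]; rewrite -!leqNgt => le21 le12.
  have p12 : p.1 = p.2 by apply/val_inj/eqP; rewrite eqn_leq le12 le21.
  by rewrite /F p12 subrr expr0n.
pose swap (p : 'I_n * 'I_n) := (p.2, p.1).
have swapK : involutive swap by case.
rewrite (reindex_inj (inv_inj swapK)) /=; apply: eq_big => p /=.
  by rewrite esym [RHS]andbC; case: ltngtP; rewrite ?andbT ?andbF.
by move=> _; rewrite /F -sqrrN opprB.
Qed.

(** The transpose of the pseudoinverse of [A] is a pseudoinverse of [A^T]. *)
Lemma pseudoinverse_sym (R : realType) n (A : 'M[R]_n) :
  A^T = A -> (pseudoinverse A)^T = pseudoinverse A.
Proof.
move=> As; have AP := pseudoinverseP A; apply: (moore_penrose_uniq _ AP).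
case: AP; set P := pseudoinverse A => APA PAP sAP sPA; split.
- by rewrite -[RHS]As -[in RHS]APA !trmx_mul As mulmxA.
- by rewrite -[in RHS]PAP !trmx_mul As mulmxA.
- by rewrite trmx_mul trmxK As -sPA trmx_mul As.
- by rewrite trmx_mul trmxK As -sAP trmx_mul As.
Qed.

(** * Effective resistance of an edge *)

(** The electrical potential [f] of a unit current from [u] to [v]: its energy
    equals its drop.  This one function replaces Thomson's principle below. *)
Lemma eff_res_potential (R : realType) n (e : rel 'I_n) (u v : 'I_n) :
  exists f : 'cV[R]_n,
    eff_res R e u v = f u 0 - f v 0 /\
    (f^T *m laplacian R e *m f) 0 0 = eff_res R e u v.
Proof.
set P := pseudoinverse (laplacian R e).
have Ps : P^T = P by apply/pseudoinverse_sym/laplacian_sym.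
exists (P *m (chi R u - chi R v)); split.
  by rewrite -chi_sub_mul /eff_res mulmxA.
rewrite /eff_res -/P trmx_mul Ps; case: (pseudoinverseP (laplacian R e)).
by rewrite -/P => _ PAP _ _; rewrite -{3}PAP !mulmxA.
Qed.

Lemma circulant_sym N (S : {set 'Z_N}) :
  symmetric_set S -> symmetric (circulant S).
Proof. by move=> Ss i j; rewrite /circulant Ss opprB. Qed.

Lemma circulant_form (R : realType) N (S : {set 'Z_N})
    (x : 'cV[R]_(Zp_trunc N).+2) :
  symmetric_set S ->
  (x^T *m laplacian R (circulant S) *m x) 0 0 *+ 2 =
  \sum_i \sum_(s in S) (x (i + s) 0 - x i 0) ^+ 2.
Proof.
move=> Ss; rewrite laplacian_form_ordered; last exact: circulant_sym.
apply: eq_bigr => i _; rewrite (reindex_inj (addrI i)) /=.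
apply: eq_big => [s|s _]; last by rewrite -sqrrN opprB.
by rewrite (circulant_sym Ss) /circulant addrAC subrr add0r.
Qed.

Lemma term_le_sum (R : realType) (I : finType) (A : pred I) (F : I -> R) i :
  (forall j, 0 <= F j) -> A i -> F i <= \sum_(j | A j) F j.
Proof.
by move=> F0 Ai; rewrite (bigD1 i) //= lerDl sumr_ge0.
Qed.

(** The potential drop [r] across [u v] is the sum of three drops along
    [u, u + s, v + s, v], whence [r ^+ 2 <= 3 * (sum of three squares)].  For each
    of the three positions, distinct [s] give distinct ordered edges, so the
    squares sum to at most [2 * r], twice the energy of the potential. *)
Lemma circulant_eff_res_le (R : realType) N (S : {set 'Z_N}) (u v : 'Z_N) :
  symmetric_set S -> circulant S u v ->
  eff_res R (circulant S) u v * #|S|%:R <= 18.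
Proof.
move=> Ss Suv; have [f []] := eff_res_potential R (circulant S) u v.
set r := eff_res _ _ _ _ => rE fE.
have DE := circulant_form f Ss; rewrite fE in DE.
set E := fun i s => (f (i + s) 0 - f i 0) ^+ 2.
have E0 i s : 0 <= E i s by exact: sqr_ge0.
have r0 : 0 <= r.
  suff: 0 <= r *+ 2 by rewrite pmulrn_lge0.
  by rewrite DE; do 2![apply: sumr_ge0 => ? _]; exact: E0.
have star i : \sum_(s in S) E i s <= r *+ 2.
  rewrite DE.
  apply: (term_le_sum (A := predT) (F := fun i => \sum_(s in S) E i s)) => //.
  by move=> j; apply: sumr_ge0.
pose t := u - v.
have rung : \sum_(s in S) E (v + s) t <= r *+ 2.
  rewrite DE; apply: (@le_trans _ _ (\sum_i E i t)).
    rewrite [leRHS](reindex_inj (addrI v)) /= [leRHS](bigID (mem S)) /= lerDl.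
    by apply: sumr_ge0.
  by apply: ler_sum => i _; apply: (term_le_sum (A := mem S) (F := E i)).
have detour s : r ^+ 2 <= 3 * (E u s + E (v + s) t + E v s).
  rewrite /E rE /t.
  have -> : v + s + (u - v) = u + s by rewrite addrC addrA subrK addrC.
  move: (f u 0) (f v 0) (f (u + s) 0) (f (v + s) 0) => a b c d.
  rewrite -subr_ge0.
  (* The identity that turns Cauchy-Schwarz into a sum of squares; the drop is
     - (c - a) + (c - d) + (d - b). *)
  have -> : 3 * ((c - a) ^+ 2 + (c - d) ^+ 2 + (d - b) ^+ 2) - (a - b) ^+ 2 =
    ((c - a) + (c - d)) ^+ 2 + ((c - a) + (d - b)) ^+ 2
    + ((c - d) - (d - b)) ^+ 2.
    by ring.
  by rewrite !addr_ge0 ?sqr_ge0.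
have sumle : r ^+ 2 * #|S|%:R <= 18 * r.
  rewrite mulr_natr -sumr_const.
  apply: (le_trans (ler_sum _ (fun s _ => detour s))).
  rewrite -mulr_sumr !big_split /=.
  have := star u; have := star v; lra.
have [->|rn0] := eqVneq r 0; first by rewrite mul0r.
by rewrite -(@ler_pM2l _ r) ?lt_def ?rn0 // mulrA -expr2 [leRHS]mulrC.
Qed.

(** * A frequency with prescribed residues *)

(** Move [y] up to the first point [y'] where [a 0 * y'] is [b 0 / 2] modulo 1,
    then treat [a 1], [a 2], ... starting from [y'].  The window length [2 / a 0]
    is self-reproducing: reaching [y'] costs at most [1 / a 0], and the later
    moves at most [2 / a 1 <= 2 / (r * a 0) <= 1 / a 0].  The latter shift
    [a 0 * t] by at most [2 / r].  Nothing moves after the last term [a K], whose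
    residue is therefore exactly 0; with [a K = N] this makes [t] a multiple of
    [1 / N]. *)
Lemma lacunary_approx (R : realType) (r : R) (b : nat -> bool) K
    (a : nat -> R) (y : R) :
  2 <= r -> (forall i, (i <= K)%N -> 0 < a i) ->
  (forall i, (i < K)%N -> r * a i <= a i.+1) ->
  exists t : R, [/\ y <= t <= y + 2 / a 0%N,
    exists j : int, a K * t = j%:~R &
    forall i, (i < K)%N ->
      exists2 e : R, 0 <= e <= 2 / r &
      exists m : int, a i * t = m%:~R + (b i)%:R / 2 + e].
Proof.
move=> r2; have r0 : 0 < r by lra.
elim: K => [|K IH] in a b y *.
  move=> /(_ 0%N isT) a0 _; exists ((Num.ceil (a 0%N * y))%:~R / a 0%N).
  have /andP[lo hi] := ceil_itv (a 0%N * y); split=> //.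
    rewrite ler_pdivlMr // mulrC hi ler_pdivrMr // mulrDl divfK ?gt_eqF //.
    by move: lo; rewrite intrB mulrC; lra.
  by exists (Num.ceil (a 0%N * y)); rewrite mulrC divfK ?gt_eqF.
move=> apos agrow; have a0 := apos 0%N isT.
set q := a 0%N * y - (b 0%N)%:R / 2.
set y' := ((Num.ceil q)%:~R + (b 0%N)%:R / 2) / a 0%N.
have ay' : a 0%N * y' = (Num.ceil q)%:~R + (b 0%N)%:R / 2.
  by rewrite mulrC divfK ?gt_eqF.
have /andP[lo hi] := ceil_itv q.
have [t [/andP[yt ty] jP tP]] := IH (fun i => a i.+1) (fun i => b i.+1) y'
  (fun i => apos i.+1) (fun i => agrow i.+1).
have rat : a 0%N * (t - y') <= 2 / r.
  rewrite ler_pdivlMr // mulrAC [X in X * _]mulrC.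
  apply: (@le_trans _ _ (a 1%N * (2 / a 1%N))); last first.
    by rewrite mulrC divfK // gt_eqF // apos.
  apply: ler_pM; rewrite ?agrow //; first by rewrite mulr_ge0 ?ltW.
    by rewrite subr_ge0.
  by rewrite lerBlDl.
have r1 : 2 / r <= 1 by rewrite ler_pdivrMr // mul1r.
exists t; split=> //.
  apply/andP; split.
    apply: le_trans yt; rewrite -(ler_pM2l a0) ay'.
    by move: hi; rewrite /q; lra.
  rewrite -(ler_pM2l a0) mulrDr [_ * (2 / _)]mulrC divfK ?gt_eqF //.
  by move: rat lo; rewrite mulrBr ay' /q intrB; lra.
case=> [_|i]; last exact: tP.
exists (a 0%N * (t - y')); first by rewrite rat mulr_ge0 ?(ltW a0) // subr_ge0.
by exists (Num.ceil q); rewrite mulrBr ay'; ring.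
Qed.

(** * Energy of a character *)

Lemma cosD_int (R : realType) (x : R) (z : int) :
  cos (x + 2 * pi * z%:~R) = cos x.
Proof.
have nat_period n u : cos (u + 2 * pi * n%:R) = cos u :> R.
  rewrite -[RHS](periodicn (@cosD2pi R) n); congr cos.
  by rewrite -mulr_natr -[pi *+ 2]mulr_natr; ring.
case: z => n; first exact: nat_period.
by rewrite NegzE -(nat_period n.+1) intrN; congr cos; ring.
Qed.

Lemma sinD_int (R : realType) (x : R) (z : int) :
  sin (x + 2 * pi * z%:~R) = sin x.
Proof.
by rewrite -!cosBpihalf -[RHS](cosD_int _ z); congr cos; ring.
Qed.

(** Addition in ['Z_N] reduces modulo [N], which changes angles that are multiples
    of [2 * pi / N] by full turns. *)
Lemma Zp_angle (R : realType) N (j : int) (x y : 'Z_N) : (1 < N)%N ->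
  exists m : int, 2 * pi * j%:~R / N%:R * (x + y)%R%:R + 2 * pi * m%:~R =
    2 * pi * j%:~R / N%:R * (x%:R + y%:R) :> R.
Proof.
move=> N1; exists (j * ((x + y) %/ N)%N%:Z).
have -> : (x + y)%R%:R = (x + y)%N%:R - ((x + y) %/ N)%N%:R * N%:R :> R.
  rewrite [in X in _ = X - _](divn_eq (x + y) N) [in RHS]natrD natrM.
  by rewrite addrAC subrr add0r /= [in X in (_ %% X)%N]Zp_cast.
have N0 : N%:R != 0 :> R by rewrite pnatr_eq0 -lt0n ltnW.
by rewrite natrD intrM /=; field.
Qed.

(** [fc] and [fs] are the real and imaginary parts of the character
    [x |-> exp (i * w * x)]; their energies together amount to
    [|exp (i * w * s) - 1| ^ 2 = 2 - 2 * cos (w * s)] on every edge of type [s].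
    Keeping the two parts together makes the sum over [x] trivial, and testing
    both is enough since Loewner inequalities add up. *)
Lemma character_energy (R : realType) N (S : {set 'Z_N}) (j : int) :
  (1 < N)%N -> symmetric_set S ->
  let w : R := 2 * pi * j%:~R / N%:R in
  let fc : 'cV[R]_(Zp_trunc N).+2 := \col_x cos (w * (x : nat)%:R) in
  let fs : 'cV[R]_(Zp_trunc N).+2 := \col_x sin (w * (x : nat)%:R) in
  (fc^T *m laplacian R (circulant S) *m fc) 0 0 +
  (fs^T *m laplacian R (circulant S) *m fs) 0 0 =
  N%:R * \sum_(s in S) (1 - cos (w * (s : nat)%:R)).
Proof.
move=> N1 Ss w fc fs; apply: (@mulIf _ 2); first by rewrite pnatr_eq0.
rewrite mulrDl !mulr_natr !circulant_form // -big_split /=.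
rewrite -mulrnAr -sumrMnl.
rewrite [LHS](eq_bigr (fun=> \sum_(s in S) (1 - cos (w * (s : nat)%:R)) *+ 2)).
  by rewrite sumr_const card_ord -[LHS]mulr_natl; congr (_ * _); rewrite Zp_cast.
move=> i _; rewrite -big_split /=; apply: eq_bigr => s _; rewrite !mxE.
have [m wE] := Zp_angle R j i s N1; rewrite -/w in wE.
rewrite -(cosD_int _ m) -(sinD_int (_ * (i + s)%R%:R) m) wE mulrDr.
rewrite cosD sinD; have := cos2Dsin2 (w * i%:R); have := cos2Dsin2 (w * s%:R).
set c1 := cos (w * s%:R); set s1 := sin (w * s%:R).
set c2 := cos (w * i%:R); set s2 := sin (w * i%:R) => h1 h2.
have -> : (c2 * c1 - s2 * s1 - c2) ^+ 2 + (s2 * c1 + c2 * s1 - s2) ^+ 2 =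
  (c2 ^+ 2 + s2 ^+ 2) * ((c1 ^+ 2 + s1 ^+ 2) + 1 - 2 * c1) by ring.
by rewrite h1 h2; ring.
Qed.

Lemma cos_near0 (R : realType) :
  exists2 d : R, 0 < d & forall x, `|x| < d -> 7 / 8 <= cos x.
Proof.
have := @continuous_cos R 0; rewrite /continuous_at cos0.
move=> /cvgrPdist_lt /(_ (1 / 8)) [] //=; first by lra.
move=> d /= d0 near0; exists d => // x xd.
have := near0 x; rewrite /ball_ /= sub0r normrN => /(_ xd).
by rewrite ltr_norml => /andP[_]; lra.
Qed.

(** With [e1], [e2] the energies of [C1], [C2] divided by [N], one has
    [e2 <= #|C2| / 8] and [e1 >= #|C1| * 15 / 8], so [e2 <= e1 / 15] and
    [(1 / 2 + eps) * (e1 + e2) <= 3 / 4 * 16 / 15 * e1 < e1]. *)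
Lemma unbalanced_character (R : realType) N (C1 C2 : {set 'Z_N}) (j : int)
    (eps : R) :
  (1 < N)%N -> symmetric_set C1 -> symmetric_set C2 -> [disjoint C1 & C2] ->
  (#|C2| <= #|C1|)%N -> (0 < #|C1|)%N -> eps <= 4^-1 ->
  let w : R := 2 * pi * j%:~R / N%:R in
  (forall s, s \in C1 -> cos (w * (s : nat)%:R) <= - (7 / 8)) ->
  (forall s, s \in C2 -> 7 / 8 <= cos (w * (s : nat)%:R)) ->
  ~ loewner_le (laplacian R (circulant C1))
      ((2^-1 + eps) *: laplacian R (circulant (C1 :|: C2))).
Proof.
move=> N1 s1 s2 dis le21 C1n0 eps4 w far near [_ form].
have sU : symmetric_set (C1 :|: C2) by move=> x; rewrite !inE s1 s2.
set fc : 'cV[R]_(Zp_trunc N).+2 := \col_x cos (w * (x : nat)%:R).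
set fs : 'cV[R]_(Zp_trunc N).+2 := \col_x sin (w * (x : nat)%:R).
have formE x : (x^T *m ((2^-1 + eps) *: laplacian R (circulant (C1 :|: C2))
      - laplacian R (circulant C1)) *m x) 0 0 =
    (2^-1 + eps) * (x^T *m laplacian R (circulant (C1 :|: C2)) *m x) 0 0
    - (x^T *m laplacian R (circulant C1) *m x) 0 0.
  by rewrite mulmxBr mulmxBl -scalemxAr -scalemxAl !mxE.
have := addr_ge0 (form fc) (form fs); rewrite !formE.
have := character_energy R j N1 s1; have := character_energy R j N1 sU.
rewrite /= -/w -/fc -/fs.
rewrite [\sum_(s in C1 :|: C2) _](big_setID C1) /= setUK.
rewrite [(C1 :|: C2) :\: C1]setDUl setDv set0U.
have -> : C2 :\: C1 = C2 by apply/setDidPl; rewrite disjoint_sym.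
have : #|C1|%:R * (15 / 8) <= \sum_(s in C1) (1 - cos (w * (s : nat)%:R)).
  rewrite mulr_natl -sumr_const; apply: ler_sum => s sC.
  by have := far s sC; lra.
have : \sum_(s in C2) (1 - cos (w * (s : nat)%:R)) <= #|C2|%:R * (1 / 8).
  rewrite mulr_natl -sumr_const; apply: ler_sum => s sC.
  by have := near s sC; lra.
have : 0 <= \sum_(s in C2) (1 - cos (w * (s : nat)%:R)).
  by apply: sumr_ge0 => s _; rewrite subr_ge0 cos_le1.
move: (\sum_(s in C1) _) (\sum_(s in C2) _) => e1 e2 e20 e2le e1ge.
move: (_ 0 0) (_ 0 0) (_ 0 0) (_ 0 0) => q1 q2 q3 q4 h1 h2.
have n12 : #|C2|%:R <= #|C1|%:R :> R by rewrite ler_nat.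
have n1 : 0 < #|C1|%:R :> R by rewrite ltr0n.
have N0 : 0 < N%:R :> R by rewrite ltr0n ltnW.
suff : (2^-1 + eps) * (e1 + e2) - e1 < 0.
  rewrite -(pmulr_rlt0 _ N0) => neg tot; move: neg.
  suff -> : N%:R * ((2^-1 + eps) * (e1 + e2) - e1) =
     (2^-1 + eps) * (N%:R * (e1 + e2)) - N%:R * e1 by rewrite -h1 -h2; lra.
  by ring.
have : (2^-1 + eps) * (e1 + e2) <= 3 / 4 * (e1 + e2).
  by apply: ler_wpM2r; lra.
by lra.
Qed.

(** * Sizes of logarithms and of the generating set *)

Lemma log6_le_nat (R : realType) (K : nat) : log6 (K%:R : R) <= K%:R.
Proof.
have ln6 : 0 < ln (6 : R) by rewrite ln_gt0 // ltr1n.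
rewrite /log6 ler_pdivrMr //; case: K => [|K]; first by rewrite ln0 // mul0r.
rewrite mulr_natl -lnXn // ler_ln ?posrE ?exprn_gt0 //.
by rewrite -natrX ler_nat ltnW // ltn_expl.
Qed.

Lemma log6_gt (R : realType) (M : R) (K : nat) :
  expR (M * ln 6) < K%:R -> M < log6 (K%:R : R).
Proof.
have ln6 : 0 < ln (6 : R) by rewrite ln_gt0 // ltr1n.
move=> h; rewrite /log6 ltr_pdivlMr // -ltr_expR lnK // posrE.
exact: lt_trans (expR_gt0 _) h.
Qed.

(** * The unbalanced frequency *)

Lemma cos_half_turn (R : realType) (d e : R) (m : int) (b : bool) :
  (forall x : R, `|x| < d -> 7 / 8 <= cos x) -> 0 <= e -> 2 * pi * e < d ->
  let c := cos (2 * pi * (m%:~R + b%:R / 2 + e)) in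
  if b then c <= - (7 / 8) else 7 / 8 <= c.
Proof.
move=> near e0 ed /=.
have := near (2 * pi * e); rewrite ger0_norm ?mulr_ge0 ?pi_ge0 // => /(_ ed).
have -> : 2 * pi * (m%:~R + b%:R / 2 + e) =
    2 * pi * e + b%:R * pi + 2 * pi * m%:~R :> R.
  by field.
rewrite cosD_int; case: b => /=; rewrite ?mul1r ?mul0r ?addr0 //.
by rewrite (@cosDpi R) lerN2.
Qed.

Lemma cos_opp_Zp (R : realType) N (j : int) (x : 'Z_N) : (1 < N)%N ->
  let w : R := 2 * pi * j%:~R / N%:R in
  cos (w * (- x)%R%:R) = cos (w * x%:R).
Proof.
move=> N1 w; have [m] := Zp_angle R j x (- x) N1.
rewrite -/w subrr mulr0 add0r => wE.
by rewrite -[RHS]cosN -(cosD_int (- _) m) wE; congr cos; ring.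
Qed.

Lemma card_pm_set N K (a : K.-tuple nat) : (1 < N)%N ->
  (forall k, (tnth a k < N)%N) ->
  (forall i k : 'I_K, (i < k)%N -> (tnth a i < tnth a k)%N) ->
  (K <= #|pm_set N a|)%N.
Proof.
move=> N1 aN amono; rewrite -[X in (X <= _)%N]card_ord.
rewrite -(card_imset predT (f := fun k => (tnth a k)%:R : 'Z_N)).
  by apply: subset_leq_card; apply: subsetUl.
move=> i k /(congr1 val) /=; rewrite !val_Zp_nat // !modn_small // => aik.
apply/val_inj; case: (ltngtP i k) => // /amono; by rewrite aik ltnn.
Qed.

(** Only the representatives [a_k] need their residues prescribed: [- a_k] lies in
    the same part as [a_k] by symmetry, and has the same cosine. *)
Lemma unbalanced_frequency (R : realType) (r d : R) N K (a : K.-tuple nat)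
    (C1 : {set 'Z_N}) :
  (1 < N)%N -> 2 <= r -> (forall x : R, `|x| < d -> 7 / 8 <= cos x) ->
  4 * pi / r < d ->
  (forall k, (0 < tnth a k < N)%N) ->
  (forall i k : 'I_K, k = i.+1 :> nat -> r * (tnth a i)%:R <= (tnth a k)%:R) ->
  (forall k, r * (tnth a k)%:R <= N%:R) ->
  symmetric_set C1 ->
  exists j : int, let w : R := 2 * pi * j%:~R / N%:R in
  forall s, s \in pm_set N a ->
    if s \in C1 then cos (w * (s : nat)%:R) <= - (7 / 8)
    else 7 / 8 <= cos (w * (s : nat)%:R).
Proof.
move=> N1 r2 near rd a0N agrow alast s1.
have N0 : N%:R != 0 :> R by rewrite pnatr_eq0 -lt0n ltnW.
(* The default value [N] is what extends the sequence by [A K = N]. *)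
pose A i := nth N a i.
have AK : A K = N by rewrite /A nth_default ?size_tuple.
have AE (k : 'I_K) : A k = tnth a k by rewrite (tnth_nth N).
have Apos i : (i <= K)%N -> 0 < (A i)%:R :> R.
  rewrite leq_eqVlt => /orP[/eqP->|iK]; first by rewrite AK ltr0n ltnW.
  by rewrite ltr0n (AE (Ordinal iK)); case/andP: (a0N (Ordinal iK)).
have Agrow i : (i < K)%N -> r * (A i)%:R <= (A i.+1)%:R.
  move=> iK; rewrite (AE (Ordinal iK)).
  have [iK1|Ki] := ltnP i.+1 K; first by rewrite (AE (Ordinal iK1)) agrow.
  by have -> : i.+1 = K; [apply/eqP; rewrite eqn_leq iK Ki | rewrite AK].
have [t [_ [j tj] tP]] :=
  lacunary_approx (fun i => (A i)%:R \in C1) 0 r2 Apos Agrow.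
exists j => w.
have gen k : if (tnth a k)%:R \in C1
    then cos (w * (((tnth a k)%:R : 'Z_N) : nat)%:R) <= - (7 / 8)
    else 7 / 8 <= cos (w * (((tnth a k)%:R : 'Z_N) : nat)%:R).
  have [e /andP[e0 er] [m atE]] := tP k (ltn_ord k); rewrite AE in atE.
  have -> : w * (((tnth a k)%:R : 'Z_N) : nat)%:R =
      2 * pi * (m%:~R + ((tnth a k)%:R \in C1)%:R / 2 + e).
    rewrite -atE val_Zp_nat // modn_small; last by case/andP: (a0N k).
    by rewrite /w -tj AK; field.
  apply: (cos_half_turn m _ near e0); apply: le_lt_trans rd.
  have -> : 4 * pi / r = 2 * pi * (2 / r) by ring.
  by apply: ler_wpM2l er; rewrite mulr_ge0 ?pi_ge0.
move=> s /setUP[] /imsetP[k _ ->]; first exact: gen.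
by rewrite -s1 cos_opp_Zp.
Qed.

Unset Implicit Arguments.

Theorem theorem1p3 (R : realType) :
  exists c K0 : R, 0 < c /\ 0 < K0 /\
  forall K : nat, K0 < K%:R ->
  exists h : K.+1.-tuple nat -> nat, (forall t, (0 < h t)%N) /\
  forall a : K.-tuple nat,
    (forall k : 'I_K, (0 < tnth a k)%N) ->
    (forall k : 'I_K, (0 < k)%N ->
       (tnth a k)%:R / (\sum_(i < K | (i < k)%N) tnth a i)%N%:R
         > 4 * log6 (K%:R : R)) ->
  forall N : nat, (h [tuple of K :: a] < N)%N ->
  let C : {set 'Z_N} := pm_set N a in
  <<C>>%g = [set: 'Z_N] ->
  let X := circulant C in
  let alpha : R := max_edge_eff_res R X in
  let eps : R := c * Num.sqrt (alpha * log6 (K%:R : R)) in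
  ~ exists C1 C2 : {set 'Z_N},
      symmetric_set C1 /\ symmetric_set C2 /\
      C1 :|: C2 = C /\ [disjoint C1 & C2] /\
      forall Ci : {set 'Z_N}, Ci = C1 \/ Ci = C2 ->
        loewner_le ((2^-1 - eps) *: laplacian R X) (laplacian R (circulant Ci)) /\
        loewner_le (laplacian R (circulant Ci)) ((2^-1 + eps) *: laplacian R X).
Proof.
have [d d0 near] := cos_near0 R.
(* [M] makes the growth rate [r > 4 * M] large enough for the angular error
   [2 * pi * (2 / r)] to fall below [d], and for [r >= 2]. *)
pose M : R := 1 + pi / d.
exists (1 / 20), (expR (M * ln 6)); split; first by lra.
split; first exact: expR_gt0.
move=> K KK0; set r : R := 4 * log6 (K%:R : R).
have Mlog := log6_gt KK0; have logK := log6_le_nat R K.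
have pid : 0 < pi / d :> R by rewrite divr_gt0 ?pi_gt0.
have r2 : 2 <= r by move: Mlog; rewrite /r /M; lra.
have rd : 4 * pi / r < d.
  rewrite ltr_pdivrMr; last by lra.
  move: Mlog; rewrite /r /M -(ltr_pM2l d0) mulrDr [d * (_ / _)]mulrC.
  by rewrite divfK ?gt_eqF //; lra.
have K0 : 0 < K%:R :> R by apply: lt_trans KK0; exact: expR_gt0.
(* The first entry of [t] is [K] itself; since [log6 K <= K], the bound ensures
   [N >= r * a_k], so that [N] continues the lacunary sequence. *)
exists (fun t => (4 * K * \sum_(x <- t) x).+1); split=> //.
move=> a a0 agrow N hN C _ X alpha eps.
have r0 : 0 < r by lra.
have prev (i k : 'I_K) : (i < k)%N -> r * (tnth a i)%:R < (tnth a k)%:R.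
  move=> ik; have k0 : (0 < k)%N by apply: leq_ltn_trans ik.
  have ai : (tnth a i <= \sum_(l < K | (l < k)%N) tnth a l)%N.
    by rewrite (bigD1 i) //= leq_addr.
  have S0 : 0 < (\sum_(l < K | (l < k)%N) tnth a l)%N%:R :> R.
    by rewrite ltr0n; apply: leq_trans ai.
  have := agrow k k0; rewrite ltr_pdivlMr // -/r; apply: le_lt_trans.
  by rewrite ler_pM2l // ler_nat.
have Kpos : (0 < K)%N by rewrite -(ltr0n R).
have N1 : (1 < N)%N by apply: leq_ltn_trans hN.
have aN (k : 'I_K) : (4 * K * tnth a k < N)%N.
  apply: leq_trans hN; rewrite ltnS; apply: leqW; rewrite leq_mul2l.
  apply/orP; right.
  rewrite big_cons big_tuple; apply: leq_trans (leq_addl _ _).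
  by rewrite (bigD1 k) //= leq_addr.
have alt (k : 'I_K) : (tnth a k < N)%N.
  by apply: leq_ltn_trans (aN k); rewrite leq_pmull // muln_gt0.
have alast k : r * (tnth a k)%:R <= N%:R.
  apply: (@le_trans _ _ (4 * K * tnth a k)%N%:R); last by rewrite ler_nat ltnW.
  by rewrite !natrM ler_wpM2r // /r ler_pM2l.
have mono (i k : 'I_K) : (i < k)%N -> (tnth a i < tnth a k)%N.
  move=> /prev ik; rewrite -(ltr_nat R); apply: le_lt_trans ik.
  by rewrite ler_peMl //; lra.
have cardC : (K <= #|C|)%N by apply: card_pm_set.
move=> [C1 [C2 [s1 [s2 [CU [dis bal]]]]]].
have sC : symmetric_set C by rewrite -CU => x; rewrite !inE s1 s2.
have alphaK : alpha * K%:R <= 18.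
  rewrite -ler_pdivlMr //; apply: bigmax_le => [|[u v] /= Xuv].
    by rewrite divr_ge0 // ltW.
  rewrite ler_pdivlMr //.
  have [e0|e0] := leP 0 (eff_res R X u v).
    apply: le_trans (circulant_eff_res_le R sC Xuv).
    by rewrite ler_wpM2l // ler_nat.
  by apply: (@le_trans _ _ 0) => //; rewrite mulr_le0_ge0 ?ltW.
have alpha0 : 0 <= alpha by apply: bigmax_ge_id.
have eps4 : eps <= 4^-1.
  have le18 : alpha * log6 (K%:R : R) <= 25.
    by apply: (le_trans (ler_wpM2l alpha0 logK)); lra.
  have : Num.sqrt (alpha * log6 (K%:R : R)) <= Num.sqrt (5 ^+ 2).
    by rewrite ler_wsqrtr //; lra.
  by rewrite sqrtr_sqr ger0_norm // /eps; lra.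
(* Only the upper bound on the larger part is violated. *)
wlog le21 : C1 C2 s1 s2 CU dis bal / (#|C2| <= #|C1|)%N.
  move=> wl; have [le|/ltnW le] := leqP #|C2| #|C1|; first exact: (wl C1 C2).
  apply: (wl C2 C1) => //; rewrite 1?setUC 1?disjoint_sym //.
  by move=> Ci [] ->; apply: bal; [right | left].
have C1pos : (0 < #|C1|)%N.
  rewrite lt0n; apply/negP => /eqP C10; move: cardC.
  rewrite -CU leqNgt => /negP; apply; apply: leq_ltn_trans (leq_card_setU _ _) _.
  by move: le21; rewrite C10 leqn0 => /eqP ->.
have [j jP] := unbalanced_frequency N1 r2 near rd
  (fun k => introT andP (conj (a0 k) (alt k)))
  (fun i k (ik : k = i.+1 :> nat) => ltW (prev i k (eq_leq (esym ik)))) alast s1.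
have [_] := bal C1 (or_introl erefl).
rewrite -/X /X -CU; apply: (unbalanced_character N1 s1 s2 dis le21 C1pos eps4).
  move=> s sC1; have := jP s; rewrite -/C -CU inE sC1; exact.
move=> s sC2; have := jP s; rewrite -/C -CU inE sC2 orbT.
by rewrite (disjointFl dis sC2); apply.
Qed.
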